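(* Let $M$ be a finite-dimensional irreducible $\mathbb{H}_k(r,n)$-module and let $\tilde\gamma$ be a weight of $M$. Then $M$ is a quotient of $M(\tilde\gamma)$.
   Context: Let $r,n\ge 1$ be integers, $\xi\in\mathbb{C}$ a primitive $r$-th root of unity, $\bar k_0\in\mathbb{C}$. Let $V_0$ be a hermitian space with orthonormal basis $e_1,\dots,e_n$. $S_n$ acts on $V_0$ by $w(e_i)=e_{w(i)}$; $(u,v)$ denotes a transposition. $\theta_i\in U(V_0)$ is the diagonal map with $\theta_i(e_i)=\xi e_i$, $\theta_i(e_j)=e_j$ for $j\ne i$; $T\simeq(\mathbb{Z}/r\mathbb{Z})^n$ is the group generated by the $\theta_i$, and $G=T\rtimes S_n\subset U(V_0)$ (the complex reflection group $G(r,1,n)$). For $u\ne v$ put $\tilde k_{u,v}=\frac{\bar k_0}{2}\sum_{m=0}^{r-1}(\theta_u^m\theta_v^{-m}+\theta_v^m\theta_u^{-m})\in\mathbb{C}T$. $\mathbb{H}_k(r,n)$ is the unital associative $\mathbb{C}$-algebra generated by $e_1,\dots,e_n$ and $t_g$ ($g\in G$), with relations: $e_ie_j=e_je_i$; $t_gt_h=t_{gh}$ ($t_1=1$); $t_{\theta_i}e_j=e_jt_{\theta_i}$ for all $i,j$; $t_{(j,j+1)}e_i=e_it_{(j,j+1)}$ for $i\ne j,j+1$; $t_{(i,i+1)}e_i=e_{i+1}t_{(i,i+1)}-\tilde k_{i,i+1}$ for $1\le i\le n-1$ (with $\tilde k_{i,i+1}\in\mathbb{C}T$ viewed in the algebra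 via $g\mapsto t_g$). $\mathcal{C}=S(V_0)\otimes\mathbb{C}T$ is the commutative subalgebra generated by the $e_i$ and $T$. For $\gamma\in V_0^*$ and $\mu\in T^\vee$ (the characters $T\to\mathbb{C}^*$), $\gamma\otimes\mu$ denotes the algebra character of $\mathcal{C}$ with $e_i\mapsto\gamma(e_i)$, $t\mapsto\mu(t)$ ($t\in T$); $\mathcal{C}^\vee$ is the set of these characters. The principal series module of $\tilde\gamma\in\mathcal{C}^\vee$ is $M(\tilde\gamma)=\mathbb{H}_k(r,n)\otimes_{\mathcal{C}}\mathbb{C}m_{\tilde\gamma}$, where $\mathbb{C}m_{\tilde\gamma}$ is the one-dimensional $\mathcal{C}$-module of character $\tilde\gamma$. For a finite-dimensional $\mathbb{H}_k(r,n)$-module $M$, $\tilde\gamma\in\mathcal{C}^\vee$ is a weight of $M$ if $M^{\mathrm{gen}}_{\tilde\gamma}=\{m\in M:\forall a\in\mathcal{C}\ \exists q\in\mathbb{N},\ (a-\tilde\gamma(a))^q m=0\}$ is nonzero, equivalently if $M_{\tilde\gamma}=\{m\in M: am=\tilde\gamma(a)m\ \forall a\in\mathcal{C}\}$ is nonzero. *)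

(* Defs.v *)
From HB Require Import structures.
From mathcomp Require Import all_boot all_order all_fingroup all_algebra.
From mathcomp Require Import boolp reals complex finmap monalg generic_quotient.
Set Implicit Arguments.
Unset Strict Implicit.
Unset Printing Implicit Defensive.
Import Order.TTheory GRing.Theory Num.Theory.
Local Open Scope ring_scope.

Section AdditiveSpan.
Variables (V : zmodType) (P : V -> Prop).

Inductive add_gen : V -> Prop :=
| add_gen0 : add_gen 0
| add_gen_in x : P x -> add_gen x
| add_genB x y : add_gen x -> add_gen y -> add_gen (x - y).

Definition add_span : {pred V} := fun x => `[< add_gen x >].

Lemma add_spanP x : reflect (add_gen x) (x \in add_span).
Proof. exact: asboolP. Qed.

Fact add_span_zmod_closed : zmod_closed add_span.
Proof.
split; first by apply/add_spanP; apply: add_gen0.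
by move=> x y /add_spanP hx /add_spanP hy; apply/add_spanP; apply: add_genB.
Qed.
HB.instance Definition _ :=
  GRing.isZmodClosed.Build V add_span add_span_zmod_closed.

Lemma mem_add_span x : P x -> x \in add_span.
Proof. by move=> Px; apply/add_spanP; apply: add_gen_in. Qed.

Lemma add_span_morph (W : zmodType) (S : zmodClosed W) (f : {additive V -> W}) :
  (forall x, P x -> f x \in S) -> forall x, x \in add_span -> f x \in S.
Proof.
move=> hf x /add_spanP; elim=> [|y /hf //|y z _ hy _ hz].
  by rewrite raddf0 rpred0.
by rewrite raddfB rpredB.
Qed.

End AdditiveSpan.

(* The quotient of an algebra A by the two-sided ideal generated by the
   differences p - q of the pairs with rel p q. *)
Section PresentedAlgebra.
Variables (K : comNzRingType) (A : algType K) (rel : A -> A -> Prop).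

Definition relator (x : A) : Prop :=
  exists a b p q, rel p q /\ x = a * (p - q) * b.

Definition rel_ideal : {pred A} := add_span relator.
HB.instance Definition _ := GRing.ZmodClosed.on rel_ideal.

Lemma rel_idealMl a x : x \in rel_ideal -> a * x \in rel_ideal.
Proof.
apply: (add_span_morph (S := rel_ideal) (f := GRing.mull_fun a idfun)) => y.
case=> [a' [b [p [q [hpq ->]]]]]; apply: mem_add_span.
by exists (a * a'), b, p, q; rewrite /= !mulrA.
Qed.

Lemma rel_idealMr a x : x \in rel_ideal -> x * a \in rel_ideal.
Proof.
apply: (add_span_morph (S := rel_ideal) (f := GRing.mulr_fun a idfun)) => y.
case=> [a' [b [p [q [hpq ->]]]]]; apply: mem_add_span.
by exists a', (b * a), p, q; rewrite /= !mulrA.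
Qed.

Lemma rel_ideal_proper (S : nzRingType) (f : {rmorphism A -> S}) :
  (forall p q, rel p q -> f p = f q) -> 1 \notin rel_ideal.
Proof.
move=> hf; apply/negP => /add_spanP h1.
suff /eqP : f 1 = 0 by rewrite rmorph1 oner_eq0.
elim: h1 => [|_ [a [b [p [q [/hf hpq ->]]]]]|x y _ hx _ hy].
- exact: rmorph0.
- by rewrite !rmorphM rmorphB hpq subrr mulr0 mul0r.
- by rewrite rmorphB hx hy subrr.
Qed.

Definition pres_alg of 1 \notin rel_ideal := Quotient.quot rel_ideal.

Hypothesis rel_proper : 1 \notin rel_ideal.
Local Notation Q := (pres_alg rel_proper).
HB.instance Definition _ := GRing.Zmodule.on Q.

Definition pres_pi (x : A) : Q := \pi_(Quotient.quot rel_ideal)%qT x.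

Lemma pres_piE x y : pres_pi x = pres_pi y <-> x - y \in rel_ideal.
Proof.
by rewrite Quotient.idealrBE; split=> [e|/eqP //]; apply/eqP.
Qed.

Lemma pres_pi_surj (u : Q) : exists x, u = pres_pi x.
Proof. by exists (repr (u : Quotient.quot rel_ideal)); exact/esym/reprK. Qed.

Lemma pres_rel p q : rel p q -> pres_pi p = pres_pi q.
Proof.
move=> hpq; apply/pres_piE/mem_add_span.
by exists 1, 1, p, q; rewrite mul1r mulr1.
Qed.

Fact pres_pi_zmod_morphism : zmod_morphism pres_pi.
Proof. by move=> x y; rewrite /pres_pi raddfB. Qed.
HB.instance Definition _ :=
  GRing.isZmodMorphism.Build A Q pres_pi pres_pi_zmod_morphism.

Let rp (u : Q) : A := repr (u : Quotient.quot rel_ideal).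
Let rpK u : pres_pi (rp u) = u. Proof. exact: reprK. Qed.
Let rpE x : rp (pres_pi x) - x \in rel_ideal.
Proof. by apply/pres_piE; rewrite rpK. Qed.

Definition pres_one : Q := pres_pi 1.
Definition pres_mul (u v : Q) : Q := pres_pi (rp u * rp v).
Definition pres_scale (c : K) (u : Q) : Q := pres_pi (c *: rp u).

Let pi_mul x y : pres_mul (pres_pi x) (pres_pi y) = pres_pi (x * y).
Proof.
apply/pres_piE.
have -> : rp (pres_pi x) * rp (pres_pi y) - x * y =
  (rp (pres_pi x) - x) * rp (pres_pi y) + x * (rp (pres_pi y) - y).
  by rewrite mulrBl mulrBr addrA addrNK.
by apply: rpredD; [apply: rel_idealMr|apply: rel_idealMl].
Qed.

Let pi_scale c x : pres_scale c (pres_pi x) = pres_pi (c *: x).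
Proof.
apply/pres_piE; rewrite -scalerBr -[_ - _]mul1r scalerAl.
by rewrite rel_idealMl.
Qed.

Ltac lift u := let x := fresh "x" in have [x ->] := pres_pi_surj u.

Fact pres_mulA : associative pres_mul.
Proof. by move=> u v w; lift u; lift v; lift w; rewrite !pi_mul mulrA. Qed.
Fact pres_mul1 : left_id pres_one pres_mul.
Proof. by move=> u; lift u; rewrite pi_mul mul1r. Qed.
Fact pres_1mul : right_id pres_one pres_mul.
Proof. by move=> u; lift u; rewrite pi_mul mulr1. Qed.
Fact pres_mulDl : left_distributive pres_mul +%R.
Proof.
by move=> u v w; lift u; lift v; lift w; rewrite -raddfD !pi_mul mulrDl raddfD.
Qed.
Fact pres_mulDr : right_distributive pres_mul +%R.
Proof.
by move=> u v w; lift u; lift v; lift w; rewrite -raddfD !pi_mul mulrDr raddfD.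
Qed.
Fact pres_1neq0 : pres_one != 0.
Proof.
apply: contra rel_proper => /eqP; rewrite -(raddf0 pres_pi) => /pres_piE.
by rewrite subr0.
Qed.
HB.instance Definition _ := GRing.Zmodule_isNzRing.Build Q
  pres_mulA pres_mul1 pres_1mul pres_mulDl pres_mulDr pres_1neq0.

Fact pres_scaleA a b u : pres_scale a (pres_scale b u) = pres_scale (a * b) u.
Proof. by lift u; rewrite !pi_scale scalerA. Qed.
Fact pres_scale1 : left_id 1 pres_scale.
Proof. by move=> u; lift u; rewrite pi_scale scale1r. Qed.
Fact pres_scaleDr : right_distributive pres_scale +%R.
Proof.
by move=> c u v; lift u; lift v; rewrite -raddfD !pi_scale scalerDr raddfD.
Qed.
Fact pres_scaleDl u : {morph pres_scale^~ u : a b / a + b}.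
Proof. by move=> a b; lift u; rewrite !pi_scale scalerDl raddfD. Qed.
HB.instance Definition _ := GRing.Zmodule_isLmodule.Build K Q
  pres_scaleA pres_scale1 pres_scaleDr pres_scaleDl.

Fact pres_scaleAl (c : K) (u v : Q) : c *: (u * v) = c *: u * v.
Proof.
by lift u; lift v; rewrite [LHS]/GRing.scale [RHS]/GRing.mul /= /GRing.mul
  /GRing.scale /= !(pi_mul, pi_scale) scalerAl.
Qed.
HB.instance Definition _ := GRing.Lmodule_isLalgebra.Build K Q pres_scaleAl.

Fact pres_scaleAr (c : K) (u v : Q) : c *: (u * v) = u * (c *: v).
Proof.
by lift u; lift v; rewrite [LHS]/GRing.scale [RHS]/GRing.mul /= /GRing.mul
  /GRing.scale /= !(pi_mul, pi_scale) scalerAr.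
Qed.
HB.instance Definition _ := GRing.Lalgebra_isAlgebra.Build K Q pres_scaleAr.

Fact pres_pi_monoid_morphism : monoid_morphism pres_pi.
Proof. by split=> // x y; rewrite -pi_mul. Qed.
HB.instance Definition _ :=
  GRing.isMonoidMorphism.Build A Q pres_pi pres_pi_monoid_morphism.
Fact pres_pi_scalable : scalable pres_pi.
Proof. by move=> c x; rewrite -pi_scale. Qed.
HB.instance Definition _ :=
  GRing.isScalable.Build K A Q *:%R pres_pi pres_pi_scalable.

End PresentedAlgebra.

(* The free associative algebra on X: the monoid algebra of the free monoid. *)
Section FreeAlgebra.
Variables (K : comNzRingType) (X : choiceType).

Definition free_alg := {malg K[{fmonom X}]}.
HB.instance Definition _ := GRing.Lalgebra.on free_alg.

Fact free_alg_scalerAr (c : K) (x y : free_alg) : c *: (x * y) = x * (c *: y).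
Proof.
apply/malgP => k.
rewrite mcoeffZ [in RHS](mcoeffMlw k (fsubset_refl (msupp x)) (msuppZ_le c y)).
rewrite [in LHS]mcoeffMl mulr_sumr; apply: eq_bigr => k1 _; rewrite mulr_sumr.
by apply: eq_bigr => k2 _; rewrite mcoeffZ mulrnAr mulrCA.
Qed.
HB.instance Definition _ := GRing.Lalgebra_isAlgebra.Build K free_alg
  free_alg_scalerAr.

Definition free_gen (x : X) : free_alg := << fmu x >>.

(* Evaluation of a noncommutative polynomial at commuting scalars. *)
Variable v : X -> K.
Definition free_eval_monom (m : {fmonom X}) : K := \prod_(x <- m) v x.

Fact free_eval_monom_mmorphism : mmorphism free_eval_monom.
Proof.
split=> [x y|]; last by rewrite /free_eval_monom fm1 big_nil.
by rewrite /free_eval_monom fmM big_cat.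
Qed.
HB.instance Definition _ := isMultiplicative.Build _ _ free_eval_monom
  free_eval_monom_mmorphism.

Definition free_eval : free_alg -> K := mmap idfun free_eval_monom.
HB.instance Definition _ := GRing.RMorphism.on free_eval.
HB.instance Definition _ := GRing.Linear.on free_eval.

Lemma free_evalX x : free_eval (free_gen x) = v x.
Proof.
by rewrite /free_eval mmapU /= mul1r /free_eval_monom fmU big_seq1.
Qed.

End FreeAlgebra.

Section GeneratedSubalgebra.
Variables (K : comNzRingType) (A : algType K) (P : A -> Prop).

Inductive alg_gen : A -> Prop :=
| alg_gen_in x : P x -> alg_gen x
| alg_gen1 : alg_gen 1
| alg_genZD c x y : alg_gen x -> alg_gen y -> alg_gen (c *: x + y)
| alg_genM x y : alg_gen x -> alg_gen y -> alg_gen (x * y).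

Definition alg_span : {pred A} := fun x => `[< alg_gen x >].

Lemma alg_spanP x : reflect (alg_gen x) (x \in alg_span).
Proof. exact: asboolP. Qed.

Fact alg_span_closed : subalg_closed alg_span.
Proof.
split; first by apply/alg_spanP; apply: alg_gen1.
- by move=> c x y /alg_spanP hx /alg_spanP hy; apply/alg_spanP; apply: alg_genZD.
- by move=> x y /alg_spanP hx /alg_spanP hy; apply/alg_spanP; apply: alg_genM.
Qed.
HB.instance Definition _ := GRing.isSubalgClosed.Build K A alg_span
  alg_span_closed.

Record gen_subalg := GenSubalg {
  gen_subalg_val : A;
  gen_subalg_mem : gen_subalg_val \in alg_span }.
HB.instance Definition _ := [isSub for gen_subalg_val].
HB.instance Definition _ := [Choice of gen_subalg by <:].
HB.instance Definition _ := [SubChoice_isSubAlgebra of gen_subalg by <:].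

Lemma mem_alg_span x : P x -> x \in alg_span.
Proof. by move=> Px; apply/alg_spanP; apply: alg_gen_in. Qed.
End GeneratedSubalgebra.

(* A (x)_B N for a morphism f : B -> A, with A seen as a right B-module
   through f: the free abelian group on A * N modulo the usual relations. *)
Section TensorProduct.
Variables (B A : nzRingType) (f : {rmorphism B -> A}) (N : lmodType B).

Local Notation Z := {malg int[(A * N)%type]}.
Local Notation "a *t x" := (<< (a, x) >> : Z) (at level 40).

Inductive tensor_rel : Z -> Prop :=
| tensor_relDl a b x : tensor_rel ((a + b) *t x - (a *t x + b *t x))
| tensor_relDr a x y : tensor_rel (a *t (x + y) - (a *t x + a *t y))
| tensor_relB a b x : tensor_rel ((a * f b) *t x - a *t (b *: x)).

Definition tensor : Type := Quotient.quot (add_span tensor_rel).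
Local Notation T := tensor.
HB.instance Definition _ := GRing.Zmodule.on T.

Definition tensor_pi (z : Z) : T := \pi_(Quotient.quot (add_span tensor_rel))%qT z.
Definition tens (a : A) (x : N) : T := tensor_pi (a *t x).

Lemma tensor_piE y z : tensor_pi y = tensor_pi z <-> y - z \in add_span tensor_rel.
Proof.
by rewrite Quotient.idealrBE; split=> [e|/eqP //]; apply/eqP.
Qed.

Lemma tensor_pi_surj (u : T) : exists z, u = tensor_pi z.
Proof.
by exists (repr (u : Quotient.quot (add_span tensor_rel))); exact/esym/reprK.
Qed.

Fact tensor_pi_zmod_morphism : zmod_morphism tensor_pi.
Proof. by move=> x y; rewrite /tensor_pi raddfB. Qed.
HB.instance Definition _ :=
  GRing.isZmodMorphism.Build Z T tensor_pi tensor_pi_zmod_morphism.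

Definition tensor_lmul (a : A) (z : Z) : Z :=
  \sum_(k <- msupp z) << z@_k *g (a * k.1, k.2) >>.

Lemma tensor_lmulEw a (d : {fset (A * N)%type}) z : (msupp z `<=` d)%fset ->
  tensor_lmul a z = \sum_(k <- d) << z@_k *g (a * k.1, k.2) >>.
Proof.
move=> le; rewrite [LHS](big_fset_incl _ le) //= => x xd /mcoeff_outdom ->.
by rewrite monalgU0.
Qed.

Fact tensor_lmul_zmod_morphism a : zmod_morphism (tensor_lmul a).
Proof.
move=> y z; pose d := (msupp y `|` msupp z)%fset.
rewrite !(tensor_lmulEw a (d := d)) ?finmap.fsubsetUl ?finmap.fsubsetUr //; last first.
  exact: msuppB_le.
by rewrite -sumrB; apply: eq_bigr => k _; rewrite mcoeffB monalgUB.
Qed.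
HB.instance Definition _ a :=
  GRing.isZmodMorphism.Build Z Z (tensor_lmul a) (tensor_lmul_zmod_morphism a).

Lemma tensor_lmulU a c k :
  tensor_lmul a << c *g k >> = << c *g (a * k.1, k.2) >>.
Proof.
by rewrite (tensor_lmulEw a msuppU_le) finmap.big_seq_fset1 mcoeffUU.
Qed.

Lemma tensor_lmul_rel a z :
  z \in add_span tensor_rel -> tensor_lmul a z \in add_span tensor_rel.
Proof.
apply: (add_span_morph (S := add_span tensor_rel) (f := tensor_lmul a)) => x.
case=> *; rewrite !(raddfB, raddfD) /= !tensor_lmulU /=; apply: mem_add_span.
- by rewrite mulrDr -opprD; apply: tensor_relDl.
- by rewrite -opprD; apply: tensor_relDr.
- by rewrite mulrA; apply: tensor_relB.
Qed.

Let rp (u : T) : Z := repr (u : Quotient.quot (add_span tensor_rel)).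
Let rpK u : tensor_pi (rp u) = u. Proof. exact: reprK. Qed.

Definition tensor_scale (a : A) (u : T) : T := tensor_pi (tensor_lmul a (rp u)).

Let pi_scale a z : tensor_scale a (tensor_pi z) = tensor_pi (tensor_lmul a z).
Proof.
apply/tensor_piE; rewrite -raddfB; apply: tensor_lmul_rel.
by apply/tensor_piE; rewrite rpK.
Qed.

Lemma tensor_ind (P : T -> Prop) :
  P 0 -> (forall u v, P u -> P v -> P (u - v)) ->
  (forall a x, P (tens a x)) -> forall u, P u.
Proof.
move=> P0 PB Pt u; have [z ->] := tensor_pi_surj u.
have PD v w : P v -> P w -> P (v + w).
  by move=> Pv Pw; rewrite -[w]opprK; apply: (PB) => //; rewrite -sub0r; apply: (PB).
rewrite (monalgE z) raddf_sum; apply: (big_ind P) => // k _.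
have -> : << z@_k *g k >> = << k >> *~ z@_k :> Z.
  by rewrite -raddfMz /= intz.
rewrite raddfMz; have := Pt k.1 k.2; rewrite /tens -surjective_pairing.
set t := tensor_pi _ => Pk; case: (z@_k) => m.
  by elim: m => [|m IH] /=; rewrite ?mulr0z // -pmulrn mulrS; apply: (PD).
rewrite NegzE mulrNz -sub0r; apply: (PB) => //.
by elim: (m.+1) => [|j IH] /=; rewrite ?mulr0z // -pmulrn mulrS; apply: (PD).
Qed.

Let tensor_scaleB a : zmod_morphism (tensor_scale a).
Proof.
move=> u v; have [y ->] := tensor_pi_surj u; have [z ->] := tensor_pi_surj v.
by rewrite -raddfB !pi_scale !raddfB.
Qed.
HB.instance Definition _ a :=
  GRing.isZmodMorphism.Build T T (tensor_scale a) (tensor_scaleB a).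

Lemma tensor_scale_tens a b x : tensor_scale a (tens b x) = tens (a * b) x.
Proof. by rewrite pi_scale tensor_lmulU. Qed.

Lemma tensDl a b x : tens (a + b) x = tens a x + tens b x.
Proof. by rewrite -raddfD; apply/tensor_piE/mem_add_span/tensor_relDl. Qed.
Lemma tensDr a x y : tens a (x + y) = tens a x + tens a y.
Proof. by rewrite -raddfD; apply/tensor_piE/mem_add_span/tensor_relDr. Qed.
Lemma tensB a b x : tens (a * f b) x = tens a (b *: x).
Proof. by apply/tensor_piE/mem_add_span/tensor_relB. Qed.

Fact tensor_scaleA a b u : tensor_scale a (tensor_scale b u) = tensor_scale (a * b) u.
Proof.
elim/tensor_ind: u => [|u v IHu IHv|c x]; first by rewrite !raddf0.
  by rewrite !raddfB /= IHu IHv.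
by rewrite !tensor_scale_tens mulrA.
Qed.
Fact tensor_scale1 : left_id 1 tensor_scale.
Proof.
elim/tensor_ind=> [|u v IHu IHv|c x]; first by rewrite !raddf0.
  by rewrite !raddfB /= IHu IHv.
by rewrite !tensor_scale_tens mul1r.
Qed.
Fact tensor_scaleDr : right_distributive tensor_scale +%R.
Proof. by move=> a u v; rewrite raddfD. Qed.
Fact tensor_scaleDl u : {morph tensor_scale^~ u : a b / a + b}.
Proof.
move=> a b; elim/tensor_ind: u => [|u v IHu IHv|c x].
- by rewrite !raddf0 addr0.
- by rewrite !raddfB /= IHu IHv opprD addrACA.
- by rewrite !tensor_scale_tens mulrDl tensDl.
Qed.
HB.instance Definition _ := GRing.Zmodule_isLmodule.Build A T
  tensor_scaleA tensor_scale1 tensor_scaleDr tensor_scaleDl.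

End TensorProduct.

Section CharacterModule.
Variables (K : comNzRingType) (B : algType K).

(* The B-module K m_chi with underlying space K. *)
Definition char_module of {lrmorphism B -> K^o} : Type := K.

Variable chi : {lrmorphism B -> K^o}.
Local Notation N := (char_module chi).
HB.instance Definition _ := GRing.Zmodule.on N.

Definition char_scale (b : B) (x : N) : N := (chi b : K) * (x : K).

Fact char_scaleA a b x : char_scale a (char_scale b x) = char_scale (a * b) x.
Proof. by rewrite /char_scale rmorphM mulrA. Qed.
Fact char_scale1 : left_id 1 char_scale.
Proof. by move=> x; rewrite /char_scale rmorph1; apply: mul1r. Qed.
Fact char_scaleDr : right_distributive char_scale +%R.
Proof. by move=> a x y; rewrite /char_scale; apply: mulrDr. Qed.
Fact char_scaleDl x : {morph char_scale^~ x : a b / a + b}.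
Proof. by move=> a b; rewrite /char_scale rmorphD; apply: mulrDl. Qed.
HB.instance Definition _ := GRing.Zmodule_isLmodule.Build B N
  char_scaleA char_scale1 char_scaleDr char_scaleDl.

End CharacterModule.

Section ModuleNotions.
Variables (K : comNzRingType) (A : algType K) (M : lmodType A).

(* Finite dimension over K, acting on M through K -> A. *)
Definition fin_dim : Prop :=
  exists s : seq M, forall m : M, exists c : 'I_(size s) -> K,
    m = \sum_i (c i)%:A *: s`_i.

(* Any subset is given by a boolean predicate, by classical logic. *)
Definition irreducible : Prop :=
  (exists m : M, m != 0) /\
  (forall S : {pred M}, GRing.submod_closed S ->
     (forall m, m \in S -> m = 0) \/ (forall m, m \in S)).

End ModuleNotions.

Section GeneratedSubgroup.
Variables (gT : groupType) (P : gT -> Prop).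
Local Open Scope group_scope.

Inductive grp_gen : gT -> Prop :=
| grp_gen_in x : P x -> grp_gen x
| grp_gen1 : grp_gen 1
| grp_genM x y : grp_gen x -> grp_gen y -> grp_gen (x * y)
| grp_genV x : grp_gen x -> grp_gen x^-1.

Definition grp_span : {pred gT} := fun x => `[< grp_gen x >].

Lemma grp_spanP x : reflect (grp_gen x) (x \in grp_span).
Proof. exact: asboolP. Qed.

Fact grp_span_closed : group_closed grp_span.
Proof.
split; first by apply/grp_spanP; apply: grp_gen1.
move=> x y /grp_spanP hx /grp_spanP hy; apply/grp_spanP.
by apply: grp_genM => //; apply: grp_genV.
Qed.

Record gen_subgrp := GenSubgrp {
  gen_subgrp_val : gT;
  gen_subgrp_mem : gen_subgrp_val \in grp_span }.
HB.instance Definition _ := [isSub for gen_subgrp_val].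
HB.instance Definition _ := [Choice of gen_subgrp by <:].
HB.instance Definition _ := SubChoice_isSubGroup.Build gT grp_span gen_subgrp
  grp_span_closed.

End GeneratedSubgroup.

Section UnitaryGroup.
Local Open Scope sesquilinear_scope.
Variables (C : numClosedFieldType) (n : nat).

Record unitary := Unitary {
  unitary_val :> 'M[C]_n;
  unitary_mem : unitary_val \is unitarymx }.
HB.instance Definition _ := [isSub for unitary_val].
HB.instance Definition _ := [Choice of unitary by <:].

Fact unitary1_subproof : (1%:M : 'M[C]_n) \is unitarymx.
Proof. by apply/unitarymxP; rewrite mul1mx trmx1 map_mx1. Qed.
Fact unitaryM_subproof (g h : unitary) : unitary_val g *m unitary_val h \is unitarymx.
Proof. by rewrite mul_unitarymx ?unitary_mem. Qed.
Fact unitaryV_subproof (g : unitary) : (unitary_val g)^t* \is unitarymx.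
Proof. by rewrite trmxC_unitary unitary_mem. Qed.

Definition unitary_one := Unitary unitary1_subproof.
Definition unitary_mul g h := Unitary (unitaryM_subproof g h).
Definition unitary_inv g := Unitary (unitaryV_subproof g).

Fact unitary_mulA : associative unitary_mul.
Proof. by move=> g h k; apply/val_inj; rewrite /= mulmxA. Qed.
Fact unitary_mul1 : left_id unitary_one unitary_mul.
Proof. by move=> g; apply/val_inj; rewrite /= mul1mx. Qed.
Fact unitary_1mul : right_id unitary_one unitary_mul.
Proof. by move=> g; apply/val_inj; rewrite /= mulmx1. Qed.
Fact unitary_mulV : right_inverse unitary_one unitary_inv unitary_mul.
Proof. by move=> g; apply/val_inj => /=; apply/unitarymxP/unitary_mem. Qed.
Fact unitary_Vmul : left_inverse unitary_one unitary_inv unitary_mul.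
Proof.
by move=> g; apply/val_inj => /=; apply/mulmx1C/unitarymxP/unitary_mem.
Qed.
HB.instance Definition _ := isGroup.Build unitary
  unitary_mulA unitary_mul1 unitary_1mul unitary_Vmul unitary_mulV.

End UnitaryGroup.

(* V_0 = C^n is the space of column vectors with its standard hermitian form. *)
Section ReflectionGroup.
Variables (C : numClosedFieldType) (r n : nat) (xi : C).
Hypothesis xi_prim : r.-primitive_root xi.
Local Open Scope sesquilinear_scope.

Definition basis_vec (i : 'I_n) : 'cV[C]_n := delta_mx i 0.

Definition theta_mx (i : 'I_n) : 'M[C]_n :=
  diag_mx (\row_j (if j == i then xi else 1)).

(* The matrix of w with w (e_i) = e_(w i). *)
Definition symm_mx (w : 'S_n) : 'M[C]_n := \matrix_(i, j) (i == w j)%:R.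

Lemma theta_mxE i j :
  theta_mx i *m basis_vec j = (if j == i then xi else 1) *: basis_vec j.
Proof.
rewrite /theta_mx /basis_vec mul_diag_mx; apply/colP => k.
by rewrite !mxE; case: (eqVneq k j) => [->|]; rewrite ?mulr1 ?mulr0.
Qed.

Lemma symm_mxE w i : symm_mx w *m basis_vec i = basis_vec (w i).
Proof.
by rewrite /basis_vec -colE; apply/colP => k; rewrite !mxE andbT.
Qed.

Lemma symm_mx_perm w : symm_mx w = (perm_mx w)^T.
Proof. by apply/matrixP=> i j; rewrite !mxE eq_sym. Qed.

Fact theta_unitary i : theta_mx i \is unitarymx.
Proof.
have xi1 : xi * xi^* = 1.
  rewrite -normCK (_ : `|xi| = 1) ?expr1n //.
  apply/eqP; rewrite -(@pexpr_eq1 _ _ r) ?(prim_order_gt0 xi_prim) //.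
  by rewrite -normrX (prim_expr_order xi_prim) normr1.
apply/unitarymxP; rewrite tr_diag_mx map_diag_mx mul_diag_mx.
apply/matrixP=> j k; rewrite !mxE.
case: (eqVneq j k) => [->|]; rewrite ?mulr0n ?mulr0 //.
by rewrite mulr1n; case: eqP => _; rewrite ?rmorph1 ?mulr1.
Qed.

Fact symm_unitary w : symm_mx w \is unitarymx.
Proof.
rewrite symm_mx_perm trmx_unitary; apply/unitarymxP.
by rewrite tr_perm_mx map_perm_mx -perm_mxM mulgV perm_mx1.
Qed.

Definition theta_U i : unitary C n := Unitary (theta_unitary i).
Definition symm_U w : unitary C n := Unitary (symm_unitary w).

Definition torus_gen (g : unitary C n) : Prop := exists i, g = theta_U i.

Definition torus := gen_subgrp torus_gen.
HB.instance Definition _ := SubGroup.on torus.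

Definition torus_theta (i : 'I_n) : torus :=
  GenSubgrp (introT (grp_spanP torus_gen _) (grp_gen_in (ex_intro _ i erefl))).

Local Open Scope group_scope.

Lemma symm_U1 : symm_U 1 = 1.
Proof. by apply/val_inj; rewrite /= symm_mx_perm perm_mx1 trmx1. Qed.

Lemma symm_UM v w : symm_U (v * w) = symm_U w * symm_U v.
Proof. by apply/val_inj; rewrite /= !symm_mx_perm perm_mxM trmx_mul. Qed.

Lemma symm_UV w : symm_U w^-1 = (symm_U w)^-1.
Proof.
by apply: (mulIg (symm_U w)); rewrite mulVg -symm_UM mulgV symm_U1.
Qed.

Lemma symm_theta w i : symm_U w * theta_U i = theta_U (w i) * symm_U w.
Proof.
apply/val_inj => /=; rewrite /theta_mx mul_diag_mx mul_mx_diag.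
apply/matrixP=> j k; rewrite !mxE.
case: (eqVneq j (w k)) => [->|_]; last by rewrite mulr0 mul0r.
by rewrite (inj_eq perm_inj) mulrC.
Qed.

Lemma torus_normal w g :
  g \in grp_span torus_gen ->
  symm_U w * g * symm_U w^-1 \in grp_span torus_gen.
Proof.
move=> /grp_spanP hg; apply/grp_spanP.
elim: hg => [_ [i ->]||x y _ hx _ hy|x _ hx].
- rewrite symm_theta -mulgA -symm_UM mulVg symm_U1 mulg1.
  by apply: grp_gen_in; exists (w i).
- by rewrite mulg1 -symm_UM mulVg symm_U1; apply: grp_gen1.
- suff -> : symm_U w * (x * y) * symm_U w^-1 =
    (symm_U w * x * symm_U w^-1) * (symm_U w * y * symm_U w^-1).
    exact: grp_genM.
  by rewrite symm_UV !mulgA mulgKV.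
- suff -> : symm_U w * x^-1 * symm_U w^-1 = (symm_U w * x * symm_U w^-1)^-1.
    exact: grp_genV.
  by rewrite symm_UV !invgM invgK mulgA.
Qed.

(* T S_n, a group because S_n normalizes T; it is the semidirect product. *)
Definition refl_pred : {pred unitary C n} :=
  fun g => `[< exists (t : torus) (w : 'S_n), g = val t * symm_U w >].

Lemma refl_predP g :
  reflect (exists (t : torus) (w : 'S_n), g = val t * symm_U w)
    (g \in refl_pred).
Proof. exact: asboolP. Qed.

Fact refl_pred_closed : group_closed refl_pred.
Proof.
split; first by apply/refl_predP; exists 1, 1; rewrite symm_U1 mulg1.
move=> _ _ /refl_predP[t [w ->]] /refl_predP[s [v ->]]; apply/refl_predP.
have hs := torus_normal (v^-1 * w) (gen_subgrp_mem s^-1).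
exists (t * GenSubgrp hs), (v^-1 * w).
set u := symm_U (v^-1 * w).
have -> : val (t * GenSubgrp hs) =
  gen_subgrp_val t * (u * (gen_subgrp_val s)^-1 * symm_U (v^-1 * w)^-1) by [].
by rewrite symm_UV -/u !mulgA mulgKV /u symm_UM symm_UV /= invgM !mulgA.
Qed.

Record refl_group := ReflGroup {
  refl_val : unitary C n;
  refl_mem : refl_val \in refl_pred }.
HB.instance Definition _ := [isSub for refl_val].
HB.instance Definition _ := [Choice of refl_group by <:].
HB.instance Definition _ :=
  SubChoice_isSubGroup.Build (unitary C n) refl_pred refl_group refl_pred_closed.

Fact refl_torus_subproof (t : torus) : val t \in refl_pred.
Proof. by apply/refl_predP; exists t, 1; rewrite symm_U1 mulg1. Qed.
Definition refl_torus (t : torus) : refl_group := ReflGroup (refl_torus_subproof t).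

Fact refl_symm_subproof w : symm_U w \in refl_pred.
Proof. by apply/refl_predP; exists 1, w; rewrite mul1g. Qed.
Definition refl_symm (w : 'S_n) : refl_group := ReflGroup (refl_symm_subproof w).

Definition refl_theta (i : 'I_n) : refl_group := refl_torus (torus_theta i).

End ReflectionGroup.

Section HeckeAlgebra.
Variables (C : numClosedFieldType) (r n : nat) (xi : C).
Hypothesis xi_prim : r.-primitive_root xi.
Variable k0 : C.

Local Notation G := (refl_group n xi_prim).
Local Notation theta := (refl_theta xi_prim).
Local Notation s i j := (refl_symm xi_prim (tperm i j)).
Local Notation F := (free_alg C ('I_n + G)%type).
Local Notation e i := (free_gen C (inl i : 'I_n + G)%type).
Local Notation t g := (free_gen C (inr g : 'I_n + G)%type).

(* The element ktilde_(u, v) of CT, written with the generators t_g. *)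
Definition ktilde (u v : 'I_n) : F :=
  (k0 / 2) *: \sum_(m < r)
    (t (theta u ^+ m * theta v ^- m)%g + t (theta v ^+ m * theta u ^- m)%g).

Inductive hecke_rel : F -> F -> Prop :=
| hecke_rel_ee i j : hecke_rel (e i * e j) (e j * e i)
| hecke_rel_tt g h : hecke_rel (t g * t h) (t (g * h)%g)
| hecke_rel_t1 : hecke_rel (t 1%g) 1
| hecke_rel_te i j : hecke_rel (t (theta i) * e j) (e j * t (theta i))
| hecke_rel_se (j j' i : 'I_n) : j' = j.+1 :> nat -> i != j -> i != j' ->
    hecke_rel (t (s j j') * e i) (e i * t (s j j'))
| hecke_rel_se' (i i' : 'I_n) : i' = i.+1 :> nat ->
    hecke_rel (t (s i i') * e i) (e i' * t (s i i') - ktilde i i').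

(* The algebra is nonzero: t_g |-> 1, e_i |-> i r k0 is a character. *)
Lemma hecke_proper : 1 \notin rel_ideal hecke_rel.
Proof.
pose v (x : 'I_n + G) : C :=
  match x with inl i => (i%:R * r%:R) * k0 | inr _ => 1 end.
have vk i j : free_eval v (ktilde i j) = r%:R * k0.
  rewrite /ktilde linearZ /= raddf_sum (eq_bigr (fun=> 2)); last first.
    by move=> m _; rewrite raddfD /= !free_evalX.
  rewrite sumr_const card_ord mulrnAr divfK ?pnatr_eq0 //.
  by rewrite mulr_natl.
have fM x y : free_eval v (x * y) = free_eval v x * free_eval v y.
  exact: rmorphM.
have fB x y : free_eval v (x - y) = free_eval v x - free_eval v y.
  exact: raddfB.
have f1 : free_eval v 1 = 1 by exact: rmorph1.
have fe i : free_eval v (e i) = i%:R * r%:R * k0 by exact: free_evalX.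
have ft g : free_eval v (t g) = 1 by exact: free_evalX.
have fC x y : free_eval v (x * y) = free_eval v (y * x).
  exact: etrans (fM x y) (etrans (mulrC _ _) (esym (fM y x))).
suff hv p q : hecke_rel p q -> free_eval v p = free_eval v q.
  exact: (rel_ideal_proper (f := free_eval v) hv).
case=> [i j|g h||i j|j j' i _ _ _|i i' hi]; try exact: fC.
- by rewrite [LHS](fM (t g) (t h)) (ft g) (ft h) (ft (g * h)%g) mulr1.
- by rewrite ft f1.
- rewrite [LHS](fM (t (s i i')) (e i)) [RHS](fB (e i' * t (s i i')) (ktilde i i')).
  rewrite [X in _ = X - _](fM (e i') (t (s i i'))) vk ft (fe i) (fe i') hi.
  by rewrite mul1r mulr1 -natr1 !mulrDl mul1r addrK.
Qed.

Definition hecke := pres_alg hecke_proper.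
HB.instance Definition _ := GRing.Algebra.on hecke.

Definition hecke_e (i : 'I_n) : hecke := pres_pi hecke_proper (e i).
Definition hecke_t (g : G) : hecke := pres_pi hecke_proper (t g).

Inductive calC_gen : hecke -> Prop :=
| calC_gen_e i : calC_gen (hecke_e i)
| calC_gen_t (t : torus n xi_prim) : calC_gen (hecke_t (refl_torus t)).

Definition calC := gen_subalg calC_gen.
HB.instance Definition _ := GRing.SubAlgebra.on calC.

Definition calC_e (i : 'I_n) : calC :=
  GenSubalg (mem_alg_span (calC_gen_e i)).
Definition calC_t (t : torus n xi_prim) : calC :=
  GenSubalg (mem_alg_span (calC_gen_t t)).

Definition calC_incl : {rmorphism calC -> hecke} :=
  (\val : calC -> hecke).

(* mu is a group morphism from T to the multiplicative group of C. *)
Definition torus_char (mu : torus n xi_prim -> C) : Prop :=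
  (forall t, mu t != 0) /\ {morph mu : s t / (s * t)%g >-> s * t}.

(* chi is the algebra character gamma (x) mu of calC. Since calC is the
   subalgebra generated by the e_i and T, these values determine chi. *)
Definition tensor_char (gamma : {linear 'cV[C]_n -> C^o})
    (mu : torus n xi_prim -> C) (chi : {lrmorphism calC -> C^o}) : Prop :=
  (forall i, chi (calC_e i) = gamma (basis_vec C i)) /\
  (forall t, chi (calC_t t) = mu t).

Definition in_calC_dual (chi : {lrmorphism calC -> C^o}) : Prop :=
  exists (gamma : {linear 'cV[C]_n -> C^o}) (mu : torus n xi_prim -> C),
    torus_char mu /\ tensor_char gamma mu chi.

Definition principal_series (chi : {lrmorphism calC -> C^o}) : lmodType hecke :=
  tensor calC_incl (char_module chi).

Definition gen_weight_space (chi : {lrmorphism calC -> C^o})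
    (M : lmodType hecke) (m : M) : Prop :=
  forall a : calC, exists q : nat,
    (calC_incl a - (chi a : C)%:A) ^+ q *: m = 0.

Definition is_weight (chi : {lrmorphism calC -> C^o}) (M : lmodType hecke) : Prop :=
  in_calC_dual chi /\ exists m : M, m != 0 /\ gen_weight_space chi m.

End HeckeAlgebra.

(* Main.v *)
Require Import Defs.
From HB Require Import structures.
From mathcomp Require Import all_boot all_order all_fingroup all_algebra.
From mathcomp Require Import boolp reals complex.
From mathcomp Require Import finmap monalg generic_quotient.
Set Implicit Arguments.
Unset Strict Implicit.
Unset Printing Implicit Defensive.
Import Order.TTheory GRing.Theory Num.Theory.
Local Open Scope ring_scope.
Local Open Scope complex_scope.

(** Frobenius reciprocity turns the claim into a search for an eigenvector.
A nonzero [v : M] on which the commutative subalgebra acts through [chi] is the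
same thing as a nonzero linear map from the one-dimensional module of [chi] to
the restriction of [M]; by [tensor_liftP] it extends to a linear map from the
principal series module to [M] that sends [1 (x) 1] to [v].  The image of that
map is a nonzero submodule of [M], hence all of [M] by irreducibility.

The eigenvector is obtained from a generalized eigenvector [m] of weight [chi].
The commutative subalgebra is generated, together with inverses in the torus,
by the finitely many commuting elements [e_i] and [t_(theta_i)].  Each
difference [x - chi x], for [x] in this list, is nilpotent on [m].  Applying to
the current vector the last power of such a difference that does not kill it,
one element of the list after the other, ends with a nonzero vector killed by
all the differences: by commutation a later step does not undo an earlier one
([common_kernel]).  Finally, the elements acting on this vector by their value
under [chi] form a subalgebra, and it contains the inverses of the
[t_(theta_i)], so it is the whole commutative subalgebra ([eigen_calC]). *)

(** * Common kernels of commuting locally nilpotent elements *)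

(** If [x ^+ q.+1] kills [m] and [x ^+ q] does not, then [x ^+ q *: m] is a
nonzero vector of the kernel of [x], on which the remaining elements of [s] are
still locally nilpotent.  The multiplier [a] is a product of powers of elements
of [s]; that it commutes with whatever commutes with [s] is what lets the
induction stay in the kernels already reached. *)
Lemma common_kernel (A : nzRingType) (M : lmodType A) (s : seq A) (m : M) :
  {in s &, forall x y, GRing.comm x y} -> m != 0 ->
  {in s, forall x, exists q, x ^+ q *: m = 0} ->
  exists a : A,
    [/\ forall b, {in s, forall x, GRing.comm b x} -> GRing.comm b a,
        a *: m != 0 & {in s, forall x, x *: (a *: m) = 0}].
Proof.
elim: s m => [|x s IH] m s_comm m0 s_nil.
  by exists 1; split=> [b _||//]; [exact: commr1 | rewrite scale1r].
have x_s : x \in x :: s by rewrite mem_head.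
have sub_s y : y \in s -> y \in x :: s by move=> ys; rewrite inE ys orbT.
have [q xq_m min_q] : exists2 q, x ^+ q.+1 *: m = 0 & x ^+ q *: m != 0.
  have ex_q : exists q, x ^+ q *: m == 0 by have [q /eqP] := s_nil x x_s; exists q.
  case: (ex_minnP ex_q) => [[|q]]; first by rewrite scale1r (negPf m0).
  move=> /eqP xq min_q; exists q => //.
  by apply/negP => /min_q; rewrite ltnn.
have [|//|y ys|a [a_comm a_m a_ker]] := IH (x ^+ q *: m).
- by move=> y z ys zs; apply: s_comm; apply: sub_s.
- have [p yp] := s_nil y (sub_s y ys); exists p.
  rewrite scalerA; have -> : y ^+ p * x ^+ q = x ^+ q * y ^+ p.
    apply: commrX; apply/commr_sym; apply: commrX.
    by apply: s_comm => //; apply: sub_s.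
  by rewrite -scalerA yp scaler0.
have xa : GRing.comm x a.
  by apply: a_comm => y ys; apply: s_comm => //; apply: sub_s.
exists (a * x ^+ q); split=> [b b_comm||y].
- apply: commrM; last by apply: commrX; apply: b_comm.
  by apply: a_comm => y ys; apply: b_comm; apply: sub_s.
- by rewrite -scalerA.
rewrite -scalerA inE => /predU1P [->|ys]; last exact: a_ker.
by rewrite scalerA xa -scalerA (scalerA x) -exprS xq_m scaler0.
Qed.

(** * Linear maps out of an extension of scalars *)

Section TensorLift.
Variables (B A : nzRingType) (f : {rmorphism B -> A}).
Variables (N : lmodType B) (M : lmodType A) (h : {additive N -> M}).
Hypothesis h_semilinear : forall b x, h (b *: x) = f b *: h x.

Local Notation Z := {malg int[(A * N)%type]}.

Definition pre_lift (z : Z) : M :=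
  \sum_(k <- msupp z) (k.1 *: h k.2) *~ z@_k.

Lemma pre_liftEw (d : {fset (A * N)%type}) z : (msupp z `<=` d)%fset ->
  pre_lift z = \sum_(k <- d) (k.1 *: h k.2) *~ z@_k.
Proof.
move=> le; rewrite [LHS](big_fset_incl _ le) //= => x xd /mcoeff_outdom ->.
by rewrite mulr0z.
Qed.

Fact pre_lift_zmod_morphism : zmod_morphism pre_lift.
Proof.
move=> y z; pose d := (msupp y `|` msupp z)%fset.
rewrite !(pre_liftEw (d := d)) ?finmap.fsubsetUl ?finmap.fsubsetUr //; last first.
  exact: msuppB_le.
by rewrite -sumrB; apply: eq_bigr => k _; rewrite mcoeffB mulrzBr.
Qed.
HB.instance Definition _ :=
  GRing.isZmodMorphism.Build Z M pre_lift pre_lift_zmod_morphism.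

Lemma pre_liftU a x : pre_lift << (a, x) >> = a *: h x.
Proof.
by rewrite (pre_liftEw msuppU_le) finmap.big_seq_fset1 mcoeffUU.
Qed.

Lemma pre_lift_rel z : z \in add_span (tensor_rel f (N := N)) -> pre_lift z = 0.
Proof.
move=> /add_spanP; elim=> [|y hy|x y _ hx _ hy].
- exact: raddf0.
- case: hy => [a b x|a x y'|a b x].
  + by rewrite raddfB [X in _ - X]raddfD /= !pre_liftU scalerDl subrr.
  + by rewrite raddfB [X in _ - X]raddfD /= !pre_liftU raddfD scalerDr subrr.
  + by rewrite raddfB /= !pre_liftU h_semilinear scalerA subrr.
- by rewrite raddfB /= hx hy subrr.
Qed.

Definition tensor_lift (u : tensor f N) : M :=
  pre_lift (repr (u : Quotient.quot (add_span (tensor_rel f (N := N))))).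

Lemma tensor_lift_pi z : tensor_lift (tensor_pi f z) = pre_lift z.
Proof.
apply/eqP; rewrite -subr_eq0 -raddfB; apply/eqP/pre_lift_rel/tensor_piE.
exact: reprK.
Qed.

Lemma tensor_lift_tens a x : tensor_lift (tens f a x) = a *: h x.
Proof. by rewrite tensor_lift_pi pre_liftU. Qed.

Fact tensor_lift_zmod_morphism : zmod_morphism tensor_lift.
Proof.
move=> u v; have [y ->] := tensor_pi_surj u; have [z ->] := tensor_pi_surj v.
by rewrite -raddfB !tensor_lift_pi raddfB.
Qed.
HB.instance Definition _ :=
  GRing.isZmodMorphism.Build (tensor f N) M tensor_lift tensor_lift_zmod_morphism.

Fact tensor_lift_scalable : scalable tensor_lift.
Proof.
move=> a; elim/tensor_ind=> [|u v IHu IHv|b x].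
- by rewrite !(scaler0, raddf0).
- by rewrite scalerBr !raddfB /= IHu IHv.
- by rewrite [a *: _]tensor_scale_tens !tensor_lift_tens scalerA.
Qed.
HB.instance Definition _ :=
  GRing.isScalable.Build A (tensor f N) M *:%R tensor_lift tensor_lift_scalable.

(** The universal property behind Frobenius reciprocity: extension of scalars
is left adjoint to restriction along [f]. *)
Lemma tensor_liftP : exists g : {linear tensor f N -> M},
  forall a x, g (tens f a x) = a *: h x.
Proof. by exists tensor_lift => a x; apply: tensor_lift_tens. Qed.

End TensorLift.

(** * Scalars acting on a module over an algebra *)

Section Scalars.
Variables (K : comNzRingType) (A : algType K) (M : lmodType A).

Lemma scale_algC (c : K) (x : A) (v : M) : x *: (c%:A *: v) = c%:A *: (x *: v).
Proof. by rewrite !scalerA mulr_algl mulr_algr. Qed.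

Lemma eigen_scale (c d : K) (x : A) (v : M) :
  x *: v = c%:A *: v -> x *: (d%:A *: v) = (c * d)%:A *: v.
Proof.
by move=> xv; rewrite scale_algC xv scalerA mulr_algl scalerA mulrC.
Qed.

Lemma eigen_mul (c d : K) (x y : A) (v : M) :
  x *: v = c%:A *: v -> y *: v = d%:A *: v -> (x * y) *: v = (c * d)%:A *: v.
Proof. by move=> xv yv; rewrite -scalerA yv; exact: eigen_scale. Qed.

Lemma eigen_linear (a c d : K) (x y : A) (v : M) :
  x *: v = c%:A *: v -> y *: v = d%:A *: v ->
  (a *: x + y) *: v = (a * c + d)%:A *: v.
Proof.
move=> xv yv.
rewrite [LHS]scalerDl yv -[a *: x]mulr_algl -scalerA xv scalerA mulr_algl scalerA.
by rewrite -!scalerDl.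
Qed.

Lemma eigen_inv (c d : K) (x y : A) (v : M) :
  y * x = 1 -> d * c = 1 -> x *: v = c%:A *: v -> y *: v = d%:A *: v.
Proof.
move=> yx dc xv.
have {1}-> : v = d%:A *: (x *: v).
  by rewrite xv scalerA mulr_algl scalerA dc !scale1r.
by rewrite scale_algC scalerA yx scale1r.
Qed.

End Scalars.

(** * Eigenvectors of the commutative subalgebra *)

Section Eigenvectors.
Variables (C : numClosedFieldType) (r n : nat) (xi : C).
Hypothesis xi_prim : r.-primitive_root xi.
Variable k0 : C.
Local Notation H := (hecke n xi_prim k0).
Local Notation he := (@hecke_e C r n xi xi_prim k0).
Local Notation ht := (@hecke_t C r n xi xi_prim k0).
Local Notation ce := (@calC_e C r n xi xi_prim k0).
Local Notation ct := (@calC_t C r n xi xi_prim k0).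
Local Notation incl := (@calC_incl C r n xi xi_prim k0).
Local Notation theta_T := (@torus_theta C r n xi xi_prim).
Local Notation theta := (@refl_theta C r n xi xi_prim).

Let pi : {rmorphism free_alg C ('I_n + refl_group n xi_prim)%type -> H} :=
  pres_pi (hecke_proper n xi_prim k0).

Let pi_rel p q : hecke_rel k0 p q -> pi p = pi q.
Proof. exact: pres_rel. Qed.

Lemma hecke_tM g h : ht (g * h)%g = ht g * ht h.
Proof. exact: etrans (esym (pi_rel (hecke_rel_tt _ g h))) (rmorphM pi _ _). Qed.

Lemma hecke_t1 : ht 1%g = 1.
Proof. exact: etrans (pi_rel (hecke_rel_t1 n xi_prim k0)) (rmorph1 pi). Qed.

Lemma hecke_ee i j : GRing.comm (he i) (he j).
Proof.
apply: etrans (esym (rmorphM pi _ _)) (etrans _ (rmorphM pi _ _)).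
exact/pi_rel/hecke_rel_ee.
Qed.

Lemma hecke_te i j : GRing.comm (ht (theta i)) (he j).
Proof.
apply: etrans (esym (rmorphM pi _ _)) (etrans _ (rmorphM pi _ _)).
exact/pi_rel/hecke_rel_te.
Qed.

Lemma refl_thetaC i j : (theta i * theta j = theta j * theta i)%g.
Proof. by do 3!apply: val_inj => /=; rewrite diag_mxC. Qed.

Lemma hecke_tt i j : GRing.comm (ht (theta i)) (ht (theta j)).
Proof. by rewrite /GRing.comm -!hecke_tM refl_thetaC. Qed.

Lemma calC_tM s t : ct (s * t)%g = ct s * ct t.
Proof.
apply: val_inj; rewrite rmorphM /= -hecke_tM.
by congr ht; apply: val_inj.
Qed.

Lemma calC_t1 : ct (1%g : torus n xi_prim) = 1.
Proof.
apply: val_inj; rewrite rmorph1 /= -hecke_t1.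
by congr ht; apply: val_inj.
Qed.

Variables (chi : {lrmorphism calC n xi_prim k0 -> C^o}) (M : lmodType H).

Definition eigenvector (v : M) (a : calC n xi_prim k0) : Prop :=
  incl a *: v = (chi a : C)%:A *: v.

Lemma eigenvector1 v : eigenvector v 1.
Proof. by rewrite /eigenvector !rmorph1 !scale1r. Qed.

Lemma eigenvectorM v a b :
  eigenvector v a -> eigenvector v b -> eigenvector v (a * b).
Proof.
by rewrite /eigenvector !rmorphM; exact: eigen_mul.
Qed.

Lemma eigenvectorZD v c a b :
  eigenvector v a -> eigenvector v b -> eigenvector v (c *: a + b).
Proof.
by rewrite /eigenvector !linearP; exact: eigen_linear.
Qed.

(** The inverse of a unit that acts on [v] by a scalar acts by the inverse
scalar, so the [theta_i] suffice to reach the whole torus. *)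
Lemma eigenvector_torus v :
  (forall i, eigenvector v (ct (theta_T i))) ->
  forall t, eigenvector v (ct t).
Proof.
move=> v_theta.
suff v_gen g : grp_gen (torus_gen xi_prim) g ->
    forall t, gen_subgrp_val t = g -> eigenvector v (ct t).
  by move=> t; apply: v_gen erefl; apply/grp_spanP; exact: gen_subgrp_mem.
elim=> {g} [g [i ->]||g1 g2 /grp_spanP g1P IH1 /grp_spanP g2P IH2
    |g /grp_spanP gP IH] t tg.
- suff -> : t = theta_T i by exact: v_theta.
  exact: val_inj.
- suff -> : t = 1%g by rewrite calC_t1; exact: eigenvector1.
  exact: val_inj.
- have -> : t = (GenSubgrp g1P * GenSubgrp g2P)%g by exact: val_inj.
  by rewrite calC_tM; apply: eigenvectorM; [exact: IH1 | exact: IH2].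
have -> : t = (GenSubgrp gP)^-1%g by exact: val_inj.
have := IH (GenSubgrp gP) erefl; move: (GenSubgrp gP) => u hu.
have uVu : ct u^-1%g * ct u = 1 by rewrite -calC_tM mulVg calC_t1.
apply: eigen_inv hu; first by rewrite -rmorphM uVu rmorph1.
by rewrite -[LHS](rmorphM chi) uVu rmorph1.
Qed.

Lemma eigen_calC v :
  (forall i, eigenvector v (ce i)) ->
  (forall i, eigenvector v (ct (theta_T i))) ->
  forall a, eigenvector v a.
Proof.
move=> v_e /eigenvector_torus v_t.
suff v_gen x : alg_gen (calC_gen (xi_prim := xi_prim) (k0 := k0)) x ->
    forall a, gen_subalg_val a = x -> eigenvector v a.
  by move=> a; apply: v_gen erefl; apply/alg_spanP; exact: gen_subalg_mem.
elim=> {x} [x [i|t]||c x y /alg_spanP xP IHx /alg_spanP yP IHy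
    |x y /alg_spanP xP IHx /alg_spanP yP IHy] a ax.
- by have -> : a = ce i by exact: val_inj.
- by have -> : a = ct t by exact: val_inj.
- have -> : a = 1 by exact: val_inj.
  exact: eigenvector1.
- have -> : a = c *: GenSubalg xP + GenSubalg yP by exact: val_inj.
  by apply: eigenvectorZD; [exact: IHx | exact: IHy].
- have -> : a = GenSubalg xP * GenSubalg yP by exact: val_inj.
  by apply: eigenvectorM; [exact: IHx | exact: IHy].
Qed.

(** [common_kernel] takes a finite list of commuting elements, so it is applied
to the [e_i] and the [t_(theta_i)] only; [eigen_calC] then covers the rest. *)
Lemma gen_weight_eigenvector (m : M) : m != 0 -> gen_weight_space chi m ->
  exists2 v : M, v != 0 & forall a, eigenvector v a.
Proof.
move=> m0 m_gen.
pose gen (x : 'I_n + 'I_n) : calC n xi_prim k0 :=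
  match x with
  | inl i => ce i
  | inr i => ct (theta_T i)
  end.
pose shift x : H := incl (gen x) - (chi (gen x) : C)%:A.
have gen_comm x y : GRing.comm (incl (gen x)) (incl (gen y)).
  case: x y => [i|i] [j|j] /=.
  - exact: hecke_ee.
  - exact/commr_sym/hecke_te.
  - exact: hecke_te.
  - exact: hecke_tt.
have comm_alg (c : C) (z : H) : GRing.comm z c%:A.
  by rewrite /GRing.comm mulr_algl mulr_algr.
have shift_comm x y : GRing.comm (shift x) (shift y).
  apply: commrB; last exact: comm_alg.
  by apply/commr_sym/commrB; [exact: gen_comm | exact: comm_alg].
have [||a [_ am a_ker]] :=
  @common_kernel _ M [seq shift x | x <- enum {: 'I_n + 'I_n}] m _ m0.
- by move=> _ _ /mapP[x _ ->] /mapP[y _ ->]; exact: shift_comm.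
- by move=> _ /mapP[x _ ->]; exact: m_gen.
have eigen_gen x : eigenvector (a *: m) (gen x).
  apply/eqP; rewrite -subr_eq0 -scalerBl; apply/eqP/a_ker.
  by apply: map_f; rewrite mem_enum.
exists (a *: m) => //; apply: eigen_calC => i.
  exact: (eigen_gen (inl i)).
exact: (eigen_gen (inr i)).
Qed.

(** The map [c |-> c v] from the one-dimensional module of [chi] is linear over
the commutative subalgebra because [v] is an eigenvector. *)
Lemma eigenvector_hom (v : M) : (forall a, eigenvector v a) ->
  exists g : {linear principal_series chi -> M},
    g (tens incl 1 ((1 : C) : char_module chi)) = v.
Proof.
move=> v_eigen; pose h (c : char_module chi) : M := (c : C)%:A *: v.
have h_zmod : zmod_morphism h by move=> c d; rewrite /h !scalerBl.
pose h_mixin := GRing.isZmodMorphism.Build (char_module chi) M h h_zmod.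
pose h_add : {additive char_module chi -> M} := HB.pack h h_mixin.
have h_semilinear b c : h_add (b *: c) = incl b *: h_add c.
  exact: esym (eigen_scale c (v_eigen b)).
have [g gE] := tensor_liftP h_semilinear.
by exists g; rewrite gE /= /h !scale1r.
Qed.

End Eigenvectors.

(** * Maps into irreducible modules *)

Lemma irreducible_surj (K : comNzRingType) (A : algType K) (P M : lmodType A)
    (g : {linear P -> M}) (x : P) :
  irreducible M -> g x != 0 -> forall m : M, exists y, g y = m.
Proof.
move=> [_ M_irr] gx0.
pose S : {pred M} := fun m => `[< exists y, g y = m >].
have S_sub : GRing.submod_closed S.
  split; first by apply/asboolP; exists 0; exact: raddf0.
  move=> a _ _ /asboolP[y <-] /asboolP[z <-]; apply/asboolP.
  by exists (a *: y + z); exact: linearP.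
have [S0|S_full m] := M_irr S S_sub; last exact/asboolP/S_full.
have gxS : g x \in S by apply/asboolP; exists x.
by rewrite (S0 _ gxS) eqxx in gx0.
Qed.

Theorem proposition3p1 (R : realType) (r n : nat) (xi k0 : R[i])
  (r_gt0 : (0 < r)%N) (n_gt0 : (0 < n)%N)
  (xi_prim : r.-primitive_root xi)
  (M : lmodType (hecke n xi_prim k0))
  (M_fin : fin_dim M) (M_irr : irreducible M)
  (chi : {lrmorphism calC n xi_prim k0 -> R[i]^o})
  (chi_weight : is_weight chi M) :
  exists f : {linear principal_series chi -> M}, forall m : M, exists x, f x = m.
Proof.
have [_ [m [m0 m_gen]]] := chi_weight.
have [v v0 v_eigen] := gen_weight_eigenvector m0 m_gen.
have [f fv] := eigenvector_hom v_eigen.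
by move: v0; rewrite -fv => fx0; exists f; exact: irreducible_surj M_irr fx0.
Qed.
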